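(* Let $(\Omega,\Sigma,\mu)$ be a measure space and let $\Phi:\Omega\times[0,\infty)\to\mathbb{R}$. If $\Phi$ is an $E$-strong Young function, then $\Phi$ is an $E$-Orlicz function.
   Context: Let $(\Omega,\Sigma,\mu)$ be a measure space and $\Phi:\Omega\times[0,\infty)\to\mathbb{R}$. $\Phi$ is an $E$-strong Young function if there exists a map $E:\Omega\times[0,\infty)\to\Omega\times[0,\infty)$ such that: for $\mu$-a.e. $t\in\Omega$, the function $u\mapsto\Phi(E(t,u))$ is convex and continuous on $[0,\infty)$, $\Phi(E(t,u))=0$ if and only if $u=0$, and $\lim_{u\to\infty}\Phi(E(t,u))=\infty$; and for each $u\in[0,\infty)$ the function $t\mapsto\Phi(E(t,u))$ is $\mu$-measurable on $\Omega$. $\Phi$ is an $E$-Orlicz function if there exists a map $E:\Omega\times[0,\infty)\to\Omega\times[0,\infty)$ such that: for $\mu$-a.e. $t\in\Omega$, the function $u\mapsto\Phi(E(t,u))$ is convex on $[0,\infty)$, $\Phi(E(t,0))=0$, $\Phi(E(t,u))>0$ for all $u\in(0,\infty)$, $\lim_{u\to\infty}\Phi(E(t,u))=\infty$, and $u\mapsto\Phi(E(t,u))$ is left continuous at $U_\Phi=\sup\{u>0:\Phi(E(t,u))<+\infty\}$ (when $U_\Phi=+\infty$, this means $\lim_{u\to\infty}\Phi(E(t,u))=+\infty$); and for each $u\in[0,\infty)$ the function $t\mapsto\Phi(E(t,u))$ is $\mu$-measurable on $\Omega$. *)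

(* Defs.v *)
From HB Require Import structures.
From mathcomp Require Import all_boot all_order all_algebra.
From mathcomp Require Import all_classical all_reals all_analysis.

Set Implicit Arguments.
Unset Strict Implicit.
Unset Printing Implicit Defensive.

Import Order.TTheory GRing.Theory Num.Theory.
Import numFieldNormedType.Exports.

Local Open Scope classical_set_scope.
Local Open Scope ring_scope.

(* A function on Omega x [0, oo) is a function on T * R of which only the values
   on [half_space] are used; a map from Omega x [0, oo) to itself is a function
   on T * R sending [half_space] to [half_space]. *)
Definition half_space (R : realType) (T : Type) : set (T * R) :=
  [set: T] `*` `[0, +oo[.

(* The supremum is taken in [0, +oo], so that of the empty set is 0. *)
Definition finiteness_bound (R : realType) (f : R -> R) : \bar R :=
  ereal_sup (0%:E |` [set u%:E | u in [set u : R | 0 < u /\ ((f u)%:E < +oo)%E]]).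

(* For U = 0 the condition is void, as [f] is considered on [0, oo) only. *)
Definition left_continuous_at (R : realType) (f : R -> R) (U : \bar R) : Prop :=
  (forall r : R, 0 < r -> U = r%:E -> f u @[u --> r^'-] --> f r) /\
  (U = +oo%E -> f u @[u --> +oo] --> +oo).

Definition strong_Young_section (R : realType) (f : R -> R) : Prop :=
  [/\ convex_function (`[0, +oo[ : set R) f,
      {within `[0, +oo[, continuous f},
      (forall u, 0 <= u -> (f u = 0 <-> u = 0)) &
      f u @[u --> +oo] --> +oo].

Definition Orlicz_section (R : realType) (f : R -> R) : Prop :=
  [/\ convex_function (`[0, +oo[ : set R) f,
      f 0 = 0,
      (forall u, 0 < u -> 0 < f u),
      f u @[u --> +oo] --> +oo &
      left_continuous_at f (finiteness_bound f)].

Definition E_strong_Young (R : realType) (d : measure_display)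
    (T : measurableType d) (mu : {measure set T -> \bar R})
    (Phi : T * R -> R) : Prop :=
  exists E : T * R -> T * R,
    [/\ set_fun (@half_space R T) (@half_space R T) E,
        {ae mu, forall t, strong_Young_section (fun u => Phi (E (t, u)))} &
        forall u, 0 <= u -> measurable_fun [set: T] (fun t => Phi (E (t, u)))].

Definition E_Orlicz (R : realType) (d : measure_display)
    (T : measurableType d) (mu : {measure set T -> \bar R})
    (Phi : T * R -> R) : Prop :=
  exists E : T * R -> T * R,
    [/\ set_fun (@half_space R T) (@half_space R T) E,
        {ae mu, forall t, Orlicz_section (fun u => Phi (E (t, u)))} &
        forall u, 0 <= u -> measurable_fun [set: T] (fun t => Phi (E (t, u)))].

(* Main.v *)
Require Import Defs.
From HB Require Import structures.
From mathcomp Require Import all_boot all_order all_algebra.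
From mathcomp Require Import all_classical all_reals all_analysis.
Import Order.TTheory GRing.Theory Num.Theory.
Import numFieldNormedType.Exports.
Local Open Scope classical_set_scope.
Local Open Scope ring_scope.

(** The same map [E] serves for both notions, so everything happens on one
    section [f] at a time. Only two clauses of the Orlicz condition take an
    argument. Positivity away from 0 is a matter of signs
    ([Young_section_gt0]): [f] is continuous, vanishes at 0 only and is
    eventually positive, so it keeps that sign on the whole positive axis. Left
    continuity at the finiteness bound reduces to divergence at infinity,
    because a real-valued [f] is finite everywhere and its bound is therefore
    never a positive real number ([finiteness_bound_neq_fin]). *)

(** A nonpositive value at [u > 0] would be followed by a positive value further
    right, and the intermediate value theorem would produce a zero at or beyond
    [u], whereas the only zero is 0. *)
Lemma Young_section_gt0 (R : realType) (f : R -> R) :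
  {within `[0, +oo[, continuous f} ->
  (forall u, 0 <= u -> (f u = 0 <-> u = 0)) ->
  f u @[u --> +oo] --> +oo ->
  forall u, 0 < u -> 0 < f u.
Proof.
move=> cf f0 fy u u0; rewrite ltNge; apply/negP => fu_le0.
have [v [uv fv0]] : exists v, u <= v /\ 0 < f v.
  apply: (@filter_ex _ (+oo : set_system R)).
  near=> v; split; near: v; first exact: nbhs_pinfty_ge (num_real _).
  exact: (proj1 (cvgryPgt _) fy).
have cuv : {within `[u, v], continuous f}.
  apply: continuous_subspaceW cf => x /=; rewrite !in_itv /= => /andP[ux _].
  by rewrite andbT (le_trans (ltW u0) ux).
have [|c] := IVT uv cuv (v := 0); first
  by rewrite ge_min le_max fu_le0 (ltW fv0) orbT.
rewrite in_itv /= => /andP[uc _] fc0.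
have c0 : 0 < c := lt_le_trans u0 uc.
by have := c0; rewrite (proj1 (f0 _ (ltW c0)) fc0) ltxx.
Unshelve. all: by end_near. Qed.

(** The point [r + 1] already exceeds a would-be real bound [r]. *)
Lemma finiteness_bound_neq_fin (R : realType) (f : R -> R) (r : R) :
  0 < r -> finiteness_bound f <> r%:E.
Proof.
move=> r0 bound_r.
have : ((r + 1)%:E <= finiteness_bound f)%E.
  apply: ereal_sup_ubound; right; exists (r + 1) => //=.
  by split; [rewrite addr_gt0|rewrite ltry].
by rewrite bound_r lee_fin gerDl leNgt ltr01.
Qed.

Lemma strong_Young_section_Orlicz (R : realType) (f : R -> R) :
  strong_Young_section f -> Orlicz_section f.
Proof.
move=> [convf contf f0 fy]; split => //.
- exact/f0.
- exact: Young_section_gt0.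
- by split => // r r0 /(finiteness_bound_neq_fin _ _ _ r0).
Qed.

Theorem theorem55 (R : realType) (d : measure_display) (T : measurableType d)
    (mu : {measure set T -> \bar R}) (Phi : T * R -> R) :
  E_strong_Young mu Phi -> E_Orlicz mu Phi.
Proof.
move=> [E [E_half young meas]]; exists E; split => //.
by apply: filterS young => t; exact: strong_Young_section_Orlicz.
Qed.
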